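(* Let $k,N\ge1$ be integers, let $X_1,\dots,X_k$ be pairwise disjoint finite sets with $|X_i|=n_i\ge2$, and let $V_i\cong\mathbb C^{n_i}$ be the fundamental representation of $\mathrm{GL}(n_i)$. Let $P_N(\mathbf x)=\sum_{f\in\mathrm{EC}(N)}w(f)$ be the generating polynomial of eventually $N$-cyclic $k$-tuples on $X_1,\dots,X_k$. Then $$P_N(\mathbf x)=(N!)^{k-1}(N-1)!\;\chi\!\left(\bigotimes_{i=1}^k\left(V_i^{\otimes(n_{i-1}-N)}\otimes\Lambda^NV_i\right)-(N+1)^k\bigotimes_{i=1}^k\left(V_i^{\otimes(n_{i-1}-(N+1))}\otimes\Lambda^{N+1}V_i\right)\right),$$ where indices are taken modulo $k$.
   Context: Indices are modulo $k$, so $X_{k+1}=X_1$ and $n_0=n_k$. A $k$-tuple $f=(f_1,\dots,f_k)$ with $f_i:X_i\to X_{i+1}$ is eventually $N$-cyclic if the iterated images $(f_k\cdots f_1)^m(X_1)$ eventually stabilize (for large $m$) to a subset of $X_1$ of cardinality $N$ on which $f_k\cdots f_1$ acts as an $N$-cycle (a single cyclic permutation of all $N$ elements); $\mathrm{EC}(N)$ is the set of these. There is one commuting variable $x_v$ for each $v\in\bigsqcup_iX_i$, and $w(f)=\prod_{i=1}^k\prod_{v\in X_i}x_{f_i(v)}$. Let $G=\prod_{i=1}^k\mathrm{GL}(n_i)$; each $V_i$ is regarded as a representation of $G$ through the projection $G\to\mathrm{GL}(n_i)$. For a representation $W$ of $G$, $\chi(W)$ is its character as a function of $\mathbf x=(x_v)$: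 the trace on $W$ of $(\mathrm{diag}(x_v)_{v\in X_1},\dots,\mathrm{diag}(x_v)_{v\in X_k})$; $\chi$ is extended additively to formal integer combinations (virtual representations). A tensor product $\bigotimes_i$ containing a factor $\Lambda^rV_j$ with $r>n_j$ (so $\Lambda^rV_j=0$) is read as $0$, even if another factor carries a formally negative tensor exponent. *)

(* Defs.v *)
From HB Require Import structures.
From mathcomp Require Import all_boot all_order all_fingroup all_algebra.
From mathcomp Require Import mxrepresentation.
From mathcomp Require Import boolp reals.
From mathcomp Require Import complex mxtens.
From mathcomp Require Import mpoly.

Set Implicit Arguments.
Unset Strict Implicit.
Unset Printing Implicit Defensive.

Import Order.TTheory GRing.Theory Num.Theory.
Local Open Scope ring_scope.

(* The index set {1, ..., k} of the X_i is 'I_k = {0, ..., k - 1}, with cyclic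
   successor ordS and predecessor ord_pred; X_1 is X i0 with i0 = 0.  The
   disjoint union of the X_i is the sigma type {i : 'I_k & X i}. *)
Section EventuallyCyclic.
Variables (k : nat) (X : 'I_k -> finType).

Definition cyctuple := {dffun forall i : 'I_k, {ffun X i -> X (ordS i)}}.

Definition cycstep (f : cyctuple) (u : {i : 'I_k & X i}) : {i : 'I_k & X i} :=
  Tagged X (f (tag u) (tagged u)).

(* The composite f_k ... f_1 around the cycle, starting at i.  After k steps one
   is back in X i, and tagged_as performs the corresponding type cast; its
   default branch is never taken, see cycreturnP. *)
Definition cycreturn (f : cyctuple) (i : 'I_k) (v : X i) : X i :=
  tagged_as (Tagged X v) (iter k (cycstep f) (Tagged X v)).

Lemma cycreturnP (f : cyctuple) (i : 'I_k) (v : X i) :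
  Tagged X (cycreturn f v) = iter k (cycstep f) (Tagged X v).
Proof.
have tagE m u : val (tag (iter m (cycstep f) u)) = ((val (tag u) + m) %% k)%N.
  elim: m => [|m IHm] /=; first by rewrite addn0 modn_small.
  by move: IHm => /= ->; rewrite -addn1 modnDml addn1 addnS.
rewrite /cycreturn.
have: tag (iter k (cycstep f) (Tagged X v)) = i.
  by apply: val_inj; rewrite tagE /= modnDr modn_small.
case: (iter _ _ _) => j w /= eq_ji; subst j.
by rewrite (@tagged_asE _ X (Tagged X v) w).
Qed.

Definition acts_as_cycle (T : finType) (c : T -> T) (A : {set T}) : Prop :=
  exists s : seq T, [/\ uniq s, s =i A & fcycle c s].

Definition eventually_cyclic (i0 : 'I_k) (N : nat) (f : cyctuple) : Prop :=
  exists A : {set X i0},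
    [/\ exists m0 : nat, forall m, (m0 <= m)%N ->
          [set iter m (@cycreturn f i0) v | v : X i0] = A,
        #|A| = N
      & acts_as_cycle (@cycreturn f i0) A].

(* The variable x_v is 'X_(enum_rank v). *)
Definition cycweight (C : comNzRingType) (f : cyctuple) :
    {mpoly C[#|{: {i : 'I_k & X i}}|]} :=
  \prod_(i < k) \prod_(v : X i) 'X_(enum_rank (Tagged X (f i v))).

Definition EC_poly (C : comNzRingType) (i0 : 'I_k) (N : nat) :
    {mpoly C[#|{: {i : 'I_k & X i}}|]} :=
  \sum_(f : cyctuple | `[< eventually_cyclic i0 N f >]) cycweight C f.

End EventuallyCyclic.

Lemma bigA_distr_dffun (C : comNzRingType) (J : finType) (T : J -> finType)
    (F : forall j, T j -> C) :
  \sum_(t : {dffun forall j, T j}) \prod_j F j (t j)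
    = \prod_j \sum_(a : T j) F j a.
Proof.
rewrite (reindex (@dffun_of_fprod J T)); last exact/onW_bij/dffun_of_fprod_bij.
pose P j := [ffun a : T j => F j a].
transitivity (\sum_(t : fprod T) \prod_(j in J) P j (t j)).
  by apply: eq_bigr => t _; apply: eq_bigr => j _; rewrite !ffunE.
rewrite big_fprod -(bigA_distr_big_dep _ (fun j => untag 0 (P j))).
apply: eq_bigr => j _; rewrite -(big_tag (fun j (a : T j) => P j a) j).
by apply: eq_bigr => a _; rewrite ffunE.
Qed.

Section TensorMatrix.
Variables (C : comNzRingType) (J : finType) (d : J -> nat).

(* The basis vectors of C^(d j_1) (x) C^(d j_2) (x) ... are indexed by the
   choices t of one basis index t j : 'I_(d j) in each factor. *)
Notation idx := {dffun forall j : J, 'I_(d j)}.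

Definition bigtensmx (A : forall j, 'M[C]_(d j)) : 'M[C]_#|{: idx}| :=
  \matrix_(s, t) \prod_j A j ((enum_val s : idx) j) ((enum_val t : idx) j).

Lemma bigtensmx1 : bigtensmx (fun j => 1%:M) = 1%:M.
Proof.
apply/matrixP => s t; rewrite !mxE.
have [->|neq_st] := eqVneq s t.
  by rewrite big1 // => j _; rewrite mxE eqxx.
have /existsP[j neq_j] :
    [exists j, (enum_val s : idx) j != (enum_val t : idx) j].
  apply: contra_neqT neq_st; rewrite negb_exists => /forallP eq_st.
  by apply/enum_val_inj/ffunP => j; apply/eqP; have := eq_st j; rewrite negbK.
by rewrite (bigD1 j) //= mxE (negbTE neq_j) mul0r.
Qed.

Lemma bigtensmxM (A B : forall j, 'M[C]_(d j)) :
  bigtensmx (fun j => A j *m B j) = bigtensmx A *m bigtensmx B.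
Proof.
apply/matrixP => s t; rewrite !mxE.
transitivity (\sum_(u : idx) \prod_j
    (A j ((enum_val s : idx) j) (u j) * B j (u j) ((enum_val t : idx) j))).
  rewrite (bigA_distr_dffun (fun j a =>
    A j ((enum_val s : idx) j) a * B j a ((enum_val t : idx) j))).
  by apply: eq_bigr => j _; rewrite mxE.
rewrite (reindex (@enum_val _ (mem {: idx}))); last exact/onW_bij/enum_val_bij.
by apply: eq_bigr => u _; rewrite !mxE big_split.
Qed.

End TensorMatrix.

Lemma tensmx1 (C : comNzRingType) (m p : nat) :
  (1%:M : 'M[C]_m) *t (1%:M : 'M[C]_p) = 1%:M.
Proof.
apply/matrixP => i j.
case: (mxtens_indexP i) => i0 i1; case: (mxtens_indexP j) => j0 j1.
rewrite tensmxE !mxE -natrM mulnb (can_eq (@mxtens_indexK _ _)).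
by rewrite xpair_eqE.
Qed.

(* Finite-dimensional representations of prod_i GL(n_i), in matrix form.  An
   element of the group is a family g with in_GL g; the value of a representation
   on other families is irrelevant.  As in mxrepresentation, the matrix of g acts
   on row vectors on the right. *)
Section Representations.
Variables (C : numFieldType) (I : finType) (n : I -> nat).

Definition mxfamily := forall i : I, 'M[C]_(n i).

Definition in_GL (g : mxfamily) : Prop := forall i, g i \in unitmx.

Structure GLrep := MkGLrep {
  rep_dim : nat;
  rep_mx :> mxfamily -> 'M[C]_rep_dim;
  rep_mx1 : rep_mx (fun i => 1%:M) = 1%:M;
  rep_mxM : forall g h, in_GL g -> in_GL h ->
    rep_mx (fun i => g i *m h i) = rep_mx g *m rep_mx h }.

Definition rep_fund (i : I) : GLrep.
Proof. by exists (n i) (fun g => g i). Defined.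

Definition rep_tens (V W : GLrep) : GLrep.
Proof.
exists (rep_dim V * rep_dim W)%N (fun g => V g *t W g).
- by rewrite !rep_mx1 tensmx1.
- by move=> g h gG hG; rewrite !rep_mxM // tensmx_mul.
Defined.

Definition rep_bigtens (J : finType) (W : J -> GLrep) : GLrep.
Proof.
exists #|{: {dffun forall j : J, 'I_(rep_dim (W j))}}|
       (fun g => bigtensmx (fun j => W j g)).
- rewrite -[RHS]bigtensmx1; apply/matrixP => s t; rewrite !mxE.
  by apply: eq_bigr => j _; rewrite rep_mx1.
- move=> g h gG hG; rewrite -bigtensmxM; apply/matrixP => s t; rewrite !mxE.
  by apply: eq_bigr => j _; rewrite rep_mxM.
Defined.

Definition rep_tpow (W : GLrep) (r : nat) : GLrep :=
  rep_bigtens (fun _ : 'I_r => W).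

Section Exterior.
Variables (W : GLrep) (r : nat).
Notation idx := {dffun forall _ : 'I_r, 'I_(rep_dim W)}.

Definition idx_swap (p q : 'I_r) (t : idx) : idx :=
  [ffun a => t (tperm p q a)].

Definition tens_basis (t : idx) : 'rV[C]_(rep_dim (rep_tpow W r)) :=
  delta_mx 0 (enum_rank t).

(* The subspace spanned by the tensors obtained as the sum of a pure tensor and
   the same pure tensor with factors p <> q exchanged; by multilinearity basis
   tensors suffice.  As 2 is invertible, this is also the span of the pure
   tensors with two equal factors. *)
Definition ext_relations : 'M[C]_(rep_dim (rep_tpow W r)) :=
  (\sum_(tpq : idx * ('I_r * 'I_r) | tpq.2.1 != tpq.2.2)
     <<(tens_basis tpq.1 + tens_basis (idx_swap tpq.2.1 tpq.2.2 tpq.1))>>)%MS.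

Lemma tens_basisM (t : idx) (g : mxfamily) :
  tens_basis t *m rep_tpow W r g
    = \sum_(u : idx) (\prod_a W g (t a) (u a)) *: tens_basis u.
Proof.
apply/rowP => s; rewrite -rowE !mxE summxE enum_rankK.
rewrite (bigD1 (enum_val s : idx)) //= [X in _ + X]big1 ?addr0.
  by rewrite !mxE enum_valK !eqxx mulr1.
move=> u neq_us; rewrite !mxE eqxx /=.
by rewrite -(inj_eq enum_val_inj) enum_rankK eq_sym (negbTE neq_us) mulr0.
Qed.

Lemma idx_swapK p q : involutive (@idx_swap p q).
Proof. by move=> t; apply/ffunP => a; rewrite !ffunE tpermK. Qed.

Lemma ext_relations_stable (g : mxfamily) :
  (ext_relations *m rep_tpow W r g <= ext_relations)%MS.
Proof.
rewrite /ext_relations sumsmxMr; apply/sumsmx_subP => -[t [p q]] /= neq_pq.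
rewrite (eqmxMr _ (genmxE _)) mulmxDl !tens_basisM.
rewrite [X in _ + X](reindex (@idx_swap p q)); last first.
  exact/onW_bij/inv_bij/idx_swapK.
rewrite -big_split /=; apply: summx_sub => u _.
have -> : \prod_a W g (idx_swap p q t a) (idx_swap p q u a)
        = \prod_a W g (t a) (u a).
  rewrite [RHS](reindex (tperm p q)); last exact/onW_bij/inv_bij/tpermK.
  by apply: eq_bigr => a _; rewrite !ffunE.
rewrite -scalerDr; apply: scalemx_sub.
by rewrite (sumsmx_sup (u, (p, q))) //= genmxE.
Qed.

Definition rep_ext : GLrep.
Proof.
exists (\rank (cokermx ext_relations))
       (fun g => in_factmod ext_relations
          (val_factmod (U := ext_relations) 1%:M *m rep_tpow W r g)).
- by rewrite rep_mx1 mulmx1 val_factmodK.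
- move=> g h gG hG; rewrite rep_mxM // mulmxA.
  set A := val_factmod _ *m rep_tpow W r g; set B := rep_tpow W r h.
  rewrite -[A in LHS](add_sub_fact_mod ext_relations) mulmxDl linearD /=.
  have /eqP-> : in_factmod ext_relations
      (val_submod (in_submod ext_relations A) *m B) == 0.
    rewrite in_factmod_eq0 (submx_trans _ (ext_relations_stable h)) //.
    by rewrite submxMr // val_submodP.
  by rewrite add0r /in_factmod /val_factmod /= !mulmxA mulmx1.
Defined.

End Exterior.

(* A formal integer combination is a finite list of coefficients and
   representations. *)
Definition virtual_rep := seq (int * GLrep).

End Representations.

Section Characters.
Variables (C : numFieldType) (I : finType) (X : I -> finType).
Notation n := (fun i => #|X i|).

Definition torus (x : {i : I & X i} -> C) : mxfamily C n :=
  fun i => diag_mx (\row_(j < #|X i|) x (Tagged X (enum_val j))).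

Lemma torus_in_GL (x : {i : I & X i} -> C) :
  (forall v, x v != 0) -> in_GL (torus x).
Proof.
move=> x_neq0 i; rewrite unitmxE det_diag unitfE.
by apply/prodf_neq0 => j _; rewrite mxE.
Qed.

Definition chi (W : GLrep C n) (x : {i : I & X i} -> C) : C := \tr (W (torus x)).

Definition virtual_chi (Z : virtual_rep C n) (x : {i : I & X i} -> C) : C :=
  \sum_(cW <- Z) cW.1%:~R * chi cW.2 x.

End Characters.

(* bigotimes_i (V_i^(n_(i-1) - r) (x) Lambda^r V_i).  The truncated subtraction
   implements the convention on negative exponents: if r > n_j for some j, then
   the factor Lambda^r V_j is zero, hence so is the whole product, and otherwise
   no exponent is negative. *)
Definition cyc_tensor (C : numFieldType) (k : nat) (X : 'I_k -> finType)
    (r : nat) : GLrep C (fun i => #|X i|) :=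
  let V := rep_fund C (fun i => #|X i|) in
  rep_bigtens (fun i : 'I_k =>
    rep_tens (rep_tpow (V i) (#|X (ord_pred i)| - r)) (rep_ext (V i) r)).

(* Main.v *)
Require Import Defs.
From HB Require Import structures.
From mathcomp Require Import all_boot all_order all_fingroup all_algebra.
From mathcomp Require Import mxrepresentation.
From mathcomp Require Import boolp reals.
From mathcomp Require Import complex mxtens.
From mathcomp Require Import mpoly.

Set Implicit Arguments.
Unset Strict Implicit.
Unset Printing Implicit Defensive.

Import Order.TTheory GRing.Theory Num.Theory.
Local Open Scope ring_scope.

(* Write p_i for the sum of the x_v over X_i, and J_r(i) for the sum of
   x_{t(1)} ... x_{t(r)} over the injections t of {1, ..., r} into X_i, so that
   J_r(i) = r! e_r(X_i).

   Characters: the relations defining Lambda^r V are exactly what the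
   antisymmetrizer kills, so the trace of a diagonal matrix on Lambda^r V is its
   trace on V^(tensor r) composed with the antisymmetrizer, which is J_r / r!.

   Counting: an eventually N-cyclic tuple has a unique cycle, with N points in
   each X_i; choosing one of its N points in X_1 amounts to choosing injections
   {1, ..., N} -> X_i.  What remains is to count the functions that lead every
   other point into the cycle.  By multilinearity of the determinant and
   det(1 - M_g) = [g has no cycle], their weighted number is a determinant
   (matrix-tree theorem).  As the out-weights of v depend only on the class of v,
   it reduces to a k x k cyclic bidiagonal determinant, and equals
   prod_i p_i^(n_(i-1) - N) - prod_i p_i^(n_(i-1) - N - 1) q_i
   with q_i the sum of x_v over the points of X_i off the cycle. Summing over the
   cycles yields
   N P_N = prod_i p_i^(n_(i-1)-N) J_N(i) - prod_i p_i^(n_(i-1)-N-1) J_(N+1)(i). *)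

(** * Characters *)

Lemma mxtrace_bigtensmx (C : comNzRingType) (J : finType) (d : J -> nat)
    (A : forall j, 'M[C]_(d j)) :
  \tr (bigtensmx A) = \prod_j \tr (A j).
Proof.
rewrite -(bigA_distr_dffun (fun j a => A j a a)) /mxtrace.
rewrite [RHS](reindex (@enum_val _ (mem {: {dffun forall j : J, 'I_(d j)}})));
  last exact/onW_bij/enum_val_bij.
by apply: eq_bigr => s _; rewrite mxE.
Qed.

Lemma mxtrace_tensmx (C : comNzRingType) (m p : nat) (A : 'M[C]_m)
    (B : 'M[C]_p) :
  \tr (A *t B) = \tr A * \tr B.
Proof.
rewrite /mxtrace big_distrlr /= pair_big /=.
rewrite (reindex (@mxtens_index m p)) /=; last first.
  by exists (@mxtens_unindex m p) => i _;
    [apply: mxtens_indexK | apply: mxtens_unindexK].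
by apply: eq_bigr => -[i j] _; rewrite tensmxE.
Qed.

(* If [a] kills [U] and [1 - a] maps into [U], then [a] identifies the quotient
   by [U] with the image of [a]. *)
Lemma mxtrace_factmod (C : fieldType) (n : nat) (U a T : 'M[C]_n) :
  (1%:M - a <= U)%MS -> U *m a = 0 -> a *m T = T *m a ->
  \tr (in_factmod U (val_factmod (U := U) 1%:M *m T)) = \tr (T *m a).
Proof.
move=> sub_a Ua aT.
set Q := val_factmod 1%:M; set P := in_factmod U (1%:M : 'M_n).
have aP : a *m P = P.
  have /eqP : in_factmod U (1%:M - a) = 0 by apply/eqP; rewrite in_factmod_eq0.
  by rewrite in_factmodE mulmxBl mul1mx subr_eq0 => /eqP.
(* [1 - P *m Q] maps into [U], which [a] kills. *)
have PQa : P *m Q *m a = a.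
  have := add_sub_fact_mod U 1%:M; rewrite -/P => /(congr1 (mulmx^~ a)).
  rewrite mul1mx mulmxDl val_factmodE -/Q => {2}<-.
  have /submxP[D ->] := val_submodP (in_submod U (1%:M : 'M_n)).
  by rewrite -(mulmxA D) Ua mulmx0 add0r.
(* By cyclicity, tr(Q T P) = tr(Q T a P) = tr(P Q a T) = tr(a T). *)
rewrite in_factmodE -/P -{1}aP -[RHS](congr1 mxtrace aT) -[in RHS]PQa.
by rewrite -[in RHS]mulmxA -(mulmxA P) [RHS]mxtrace_mulC aT !mulmxA.
Qed.

Section ExteriorTrace.
Variables (C : numFieldType) (I : finType) (n : I -> nat).
Variables (W : GLrep C n) (r : nat).
Notation idx := {dffun forall _ : 'I_r, 'I_(rep_dim W)}.

Definition idx_perm (s : 'S_r) (t : idx) : idx := [ffun a => t (s a)].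

Lemma idx_permM s1 s2 t : idx_perm (s1 * s2)%g t = idx_perm s1 (idx_perm s2 t).
Proof. by apply/ffunP => a; rewrite !ffunE permM. Qed.

Lemma idx_perm1 t : idx_perm 1%g t = t.
Proof. by apply/ffunP => a; rewrite !ffunE perm1. Qed.

Lemma idx_perm_bij s : bijective (idx_perm s).
Proof.
by exists (idx_perm s^-1%g) => t; rewrite -idx_permM ?mulVg ?mulgV idx_perm1.
Qed.

(** The antisymmetrizer, normalised so as to be the identity modulo [ext_relations]. *)
Definition altmx : 'M[C]_(rep_dim (rep_tpow W r)) :=
  \matrix_(p, q) ((r`!)%:R^-1 *
    \sum_(s : 'S_r) (-1) ^+ s * (enum_val q == idx_perm s (enum_val p))%:R).

Lemma tens_basis_altmx t :
  tens_basis t *m altmx =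
  (r`!)%:R^-1 *: \sum_(s : 'S_r) (-1) ^+ s *: tens_basis (idx_perm s t).
Proof.
apply/rowP => q; rewrite -rowE !mxE summxE enum_rankK; congr (_ * _).
by apply: eq_bigr => s _; rewrite !mxE eqxx /= -[in RHS](inj_eq enum_val_inj) enum_rankK.
Qed.

Lemma tens_basis_span m (A B : 'M[C]_(rep_dim (rep_tpow W r), m)) :
  (forall t, tens_basis t *m A = tens_basis t *m B) -> A = B.
Proof.
move=> eqAB; apply/row_matrixP => i.
by have := eqAB (enum_val i); rewrite /tens_basis enum_valK -!rowE.
Qed.

(** Permuting tensor factors commutes with applying one matrix in every factor: reindex the basis
    tensors by [idx_perm s] and the factors by [s]. *)
Lemma altmx_comm g : altmx *m rep_tpow W r g = rep_tpow W r g *m altmx.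
Proof.
apply: tens_basis_span => t; rewrite !mulmxA tens_basis_altmx tens_basisM.
rewrite -scalemxAl !mulmx_suml.
under [RHS]eq_bigr do rewrite -scalemxAl tens_basis_altmx scalerA mulrC -scalerA.
rewrite -scaler_sumr; congr (_ *: _).
under [RHS]eq_bigr do rewrite scaler_sumr.
rewrite exchange_big /=; apply: eq_bigr => s _.
rewrite -scalemxAl tens_basisM scaler_sumr.
rewrite (reindex (idx_perm s)); last exact/onW_bij/idx_perm_bij.
apply: eq_bigr => u _; rewrite !scalerA mulrC; congr (_ * _ *: _).
rewrite [RHS](reindex_inj (@perm_inj _ s)).
by apply: eq_bigr => a _; rewrite !ffunE.
Qed.

(** Serves twice: the antisymmetrizer kills the exchange relations, and it has zero diagonal entry
    at a basis tensor with a repeated factor. *)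
Lemma sum_perm_swap (V : lmodType C) (p q : 'I_r) (F : 'S_r -> V) :
  p != q -> \sum_(s : 'S_r) (-1) ^+ s *: F (s * tperm p q)%g =
  - \sum_(s : 'S_r) (-1) ^+ s *: F s.
Proof.
move=> neq_pq; rewrite [in RHS](reindex_inj (mulIg (tperm p q))) -sumrN.
apply: eq_bigr => s _.
by rewrite odd_permM odd_tperm neq_pq signr_addb expr1 mulrN1 scaleNr opprK.
Qed.

Lemma ext_relations_altmx : ext_relations W r *m altmx = 0.
Proof.
apply/eqP; rewrite -submx0 sumsmxMr; apply/sumsmx_subP => -[t [p q]] /= neq_pq.
rewrite (eqmxMr _ (genmxE _)) submx0 mulmxDl !tens_basis_altmx -scalerDr.
rewrite [X in _ + X](_ : _ = - \sum_(s : 'S_r) (-1) ^+ s *: tens_basis (idx_perm s t));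
  first by rewrite subrr scaler0.
rewrite -(sum_perm_swap _ neq_pq); apply: eq_bigr => s _; congr (_ *: tens_basis _).
by apply/ffunP => a; rewrite !ffunE permM.
Qed.

(** Induction on a factorisation of [s] into transpositions: each one costs a generator of
    [ext_relations], and the differences telescope. *)
Lemma ext_relations_perm (s : 'S_r) (t : idx) :
  (tens_basis t - (-1) ^+ s *: tens_basis (idx_perm s t) <= ext_relations W r)%MS.
Proof.
have [ts -> ] := prod_tpermP s.
elim: ts t => [|[p q] ts IH] t /=.
  by rewrite big_nil odd_perm1 idx_perm1 scale1r subrr sub0mx.
case/andP => /= neq_pq /IH{}IH; rewrite big_cons /=.
set s' := (\prod_(_ <- ts) _)%g in IH *.
rewrite odd_mul_tperm neq_pq signr_addb expr1 mulN1r idx_permM.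
rewrite -[X in (X <= _)%MS](subrKA ((-1) ^+ s' *: tens_basis (idx_perm s' t))).
rewrite addmx_sub ?IH // scaleNr opprK -scalerDr scalemx_sub //.
rewrite /ext_relations (sumsmx_sup (idx_perm s' t, (p, q))) //= genmxE.
by rewrite (_ : idx_swap p q _ = idx_perm (tperm p q) (idx_perm s' t)).
Qed.

(** Average [ext_relations_perm] over all permutations; r! is invertible in characteristic 0. *)
Lemma sub_altmx : (1%:M - altmx <= ext_relations W r)%MS.
Proof.
apply/row_subP => i; rewrite rowE.
have -> : delta_mx 0 i = tens_basis (enum_val i) by rewrite /tens_basis enum_valK.
rewrite mulmxBr mulmx1 tens_basis_altmx; set t := enum_val i.
have r_neq0 : (r`!)%:R != 0 :> C by rewrite pnatr_eq0 -lt0n fact_gt0.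
have -> : tens_basis t = (r`!)%:R^-1 *: \sum_(s : 'S_r) tens_basis t.
  rewrite sumr_const card_Sn.
  by rewrite -scaler_nat scalerA mulVf // scale1r.
rewrite -scalerBr scalemx_sub // -sumrB.
by apply: summx_sub => s _; apply: ext_relations_perm.
Qed.

(** [mxtrace_factmod] moves the trace to the tensor power. There the diagonal entry at [t] is the
    weight of [t] over r!, times the sum of the signs of the permutations fixing [t]: 1 if [t] is
    injective, else 0. *)
Lemma tr_rep_ext_diag g (d : 'I_(rep_dim W) -> C) :
    W g = diag_mx (\row_j d j) ->
  \tr (rep_ext W r g) =
  (r`!)%:R^-1 * \sum_(t : {ffun 'I_r -> 'I_(rep_dim W)} | injectiveb t)
     \prod_a d (t a).
Proof.
move=> Wg.
rewrite [LHS](mxtrace_factmod sub_altmx ext_relations_altmx (altmx_comm g)).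
pose w (t : idx) := \prod_a d (t a).
have tT t : tens_basis t *m rep_tpow W r g = w t *: tens_basis t.
  rewrite tens_basisM (bigD1 t) //= [X in _ + X]big1 ?addr0 => [|u neq_ut].
    by congr (_ *: _); apply: eq_bigr => a _; rewrite Wg !mxE eqxx.
  have [a neq_a] : exists a, t a != u a.
    apply/existsP; apply: contra_neqT neq_ut; rewrite negb_exists.
    by move=> /forallP eq_ut; apply/ffunP => a; have /negPn/eqP-> := eq_ut a.
  by rewrite (bigD1 a) //= Wg !mxE (negbTE neq_a) mul0r scale0r.
have trE (A : 'M[C]_(rep_dim (rep_tpow W r))) :
    \tr A = \sum_(t : idx) (tens_basis t *m A) 0 (enum_rank t).
  rewrite [LHS](reindex (@enum_rank idx)); last exact/onW_bij/enum_rank_bij.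
  by apply: eq_bigr => t _; rewrite -rowE mxE.
rewrite trE [in RHS]big_mkcond mulr_sumr /=; apply: eq_bigr => t _.
rewrite mulmxA tT -scalemxAl tens_basis_altmx !mxE mulrCA; congr (_ * _).
rewrite summxE.
have -> : \sum_s ((-1) ^+ (s : 'S_r) *: tens_basis (idx_perm s t)) 0 (enum_rank t)
          = \sum_(s : 'S_r) (-1) ^+ s *: ((t == idx_perm s t)%:R : C^o).
  by apply: eq_bigr => s _; rewrite !mxE eqxx /= (inj_eq enum_rank_inj).
case: ifP => [/injectiveP inj_t | /negbT/injectivePn[p [q neq_pq eq_t]]].
  rewrite (bigD1 1%g) //= [X in _ + X]big1 ?addr0 => [|s s_neq1].
    by rewrite odd_perm1 idx_perm1 eqxx scale1r mulr1.
  case: eqP => [/ffunP e | _]; last by rewrite scaler0.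
  case/eqP: s_neq1; apply/permP => a; apply: inj_t.
  by have := e a; rewrite ffunE perm1.
(* It suffices that the signed sum equals its opposite, and exchanging the positions [p] and [q] of
   equal entries shows this. *)
apply/eqP; rewrite mulf_eq0 -[X in _ || X]eqNr; apply/orP; right; apply/eqP.
pose F s : C^o := (t == idx_perm s t)%:R.
rewrite -[LHS](sum_perm_swap F neq_pq); apply: eq_bigr => s _.
rewrite /F; suff -> : idx_perm (s * tperm p q)%g t = idx_perm s t by [].
apply/ffunP => a; rewrite !ffunE permM.
by case: tpermP => // ->.
Qed.

End ExteriorTrace.

(** The J_r of the overview. It vanishes for [r > #|T|], in agreement with the zero exterior
    power. *)
Definition injsum (C : pzSemiRingType) (T : finType) (y : T -> C) (r : nat) : C :=
  \sum_(t : {ffun 'I_r -> T} | injectiveb t) \prod_a y (t a).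

Lemma chi_cyc_tensor (C : numFieldType) (k : nat) (X : 'I_k -> finType)
    (r : nat) (x : {i : 'I_k & X i} -> C) :
  chi (cyc_tensor C X r) x =
  \prod_i ((\sum_(v : X i) x (Tagged X v)) ^+ (#|X (ord_pred i)| - r) *
    ((r`!)%:R^-1 * injsum (fun v : X i => x (Tagged X v)) r)) :> C.
Proof.
rewrite /chi mxtrace_bigtensmx; apply: eq_bigr => i _.
rewrite mxtrace_tensmx; congr (_ * _).
  rewrite mxtrace_bigtensmx prodr_const card_ord mxtrace_diag; congr (_ ^+ _).
  rewrite [RHS](reindex (@enum_val _ (mem (X i)))); last exact/onW_bij/enum_val_bij.
  by apply: eq_bigr => j _; rewrite mxE.
rewrite (@tr_rep_ext_diag _ _ _ (rep_fund C _ i) r _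
  (fun j => x (Tagged X (enum_val j)))) //.
congr (_ * _); rewrite /injsum.
pose h (t : {ffun 'I_r -> 'I_#|X i|}) := [ffun a => enum_val (t a)] : {ffun 'I_r -> X i}.
rewrite [RHS](reindex h) /=; last first.
  exists (fun t => [ffun a => enum_rank (t a)]) => t _; apply/ffunP => a;
    by rewrite !ffunE ?enum_valK ?enum_rankK.
apply: eq_big => t; last by move=> _; apply: eq_bigr => a _; rewrite ffunE.
apply/injectiveP/injectiveP => inj_t a b; last first.
  by move=> eq_ab; apply: inj_t; rewrite !ffunE eq_ab.
by rewrite !ffunE => /enum_val_inj/inj_t.
Qed.

(** * Weighted forests *)

(** Multilinearity in the rows: [f] records the summand chosen in each row. *)
Lemma det_row_sum (R : comNzRingType) (n : nat) (Y : finType)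
    (w : 'I_n -> Y -> R) (K : 'I_n -> Y -> 'I_n -> R) :
  \det (\matrix_(a, b) \sum_y w a y * K a y b) =
  \sum_(f : {ffun 'I_n -> Y}) (\prod_a w a (f a)) * \det (\matrix_(a, b) K a (f a) b).
Proof.
rewrite /determinant.
under eq_bigr => s _.
  under eq_bigr do rewrite mxE.
  rewrite bigA_distr_bigA mulr_sumr.
  over.
rewrite exchange_big /=; apply: eq_bigr => f _.
rewrite mulr_sumr; apply: eq_bigr => s _.
rewrite big_split mulrCA; congr (_ * (_ * _)).
by apply: eq_bigr => a _; rewrite mxE.
Qed.

(* [h v = None] means that [v] is a root or is sent directly to one. *)
Definition rooted (T : Type) (h : T -> option T) : Prop :=
  forall v, exists m, iter m (obind h) (Some v) = None.

(** If all orbits end, the matrix is unitriangular for the order by distance to [None]. Otherwise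
    the indicator of the points whose orbit never ends is a kernel vector. *)
Lemma det_rooted (R : comNzRingType) (n : nat) (h : 'I_n -> option 'I_n) :
  \det (\matrix_(a, b) ((a == b)%:R - (h a == Some b)%:R)) =
  (`[< rooted h >])%:R :> R.
Proof.
set M := \matrix_(a, b) _; have [root_h | ] := asboolP (rooted h).
  (* [r v] is the least number of steps from [v] to [None]. *)
  pose r v := ex_minn (ex_intro (fun m => iter m (obind h) (Some v) == None) _
    (introT eqP (proj2_sig (cid (root_h v))))).
  have r_lt v u : h v = Some u -> (r u < r v)%N.
    move=> huv; rewrite /r; case: ex_minnP => m /eqP Em m_min.
    case: ex_minnP => -[|p] /eqP //; rewrite iterSr /= huv => /eqP Ep _.
    by rewrite ltnS m_min.
  rewrite /determinant (bigD1 1%g) //= [X in _ + X]big1 ?addr0.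
    rewrite odd_perm1 mul1r big1 // => a _; rewrite mxE perm1 eqxx.
    by case: eqP => [/r_lt|]; rewrite ?ltnn ?subr0.
  move=> s s_neq1; have [/forallP all_step | ] :=
      boolP [forall a, (s a == a) || (h a == Some (s a))]; last first.
    rewrite negb_forall => /existsP[a]; rewrite negb_or => /andP[/negbTE sa /negbTE ha].
    by rewrite (bigD1 a) //= mxE eq_sym sa ha subrr mul0r mulr0.
  (* A permutation with non-zero term never increases [r]; it preserves the total of [r], so it can
     nowhere decrease it and must be the identity. *)
  have le_r a : (r (s a) <= r a)%N.
    by case/orP: (all_step a) => /eqP => [-> // | /r_lt/ltnW].
  have eq_r : (\sum_a r (s a) = \sum_a r a)%N
    by rewrite [RHS](reindex_inj (@perm_inj _ s)).
  case/eqP: s_neq1; apply/permP => a; rewrite perm1.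
  case/orP: (all_step a) => /eqP // /r_lt lt_r; exfalso.
  move: eq_r; rewrite (bigD1 a) //= [RHS](bigD1 a) //= => eq_r.
  have : (\sum_(b | b != a) r (s b) <= \sum_(b | b != a) r b)%N by apply: leq_sum.
  rewrite leqNgt => /negP; apply.
  by rewrite -(ltn_add2l (r (s a))) eq_r ltn_add2r.
case/existsNP => v0 /forallNP v0_bad /=.
pose z : 'cV[R]_n := \col_b (`[< forall m, iter m (obind h) (Some b) <> None >])%:R.
have Mz : M *m z = 0.
  apply/colP => a; rewrite !mxE.
  under eq_bigr do rewrite !mxE mulrBl.
  rewrite sumrB (bigD1 a) //= eqxx mul1r [X in _ + X - _]big1 => [|b]; last first.
    by rewrite eq_sym => /negbTE ->; rewrite mul0r.
  rewrite addr0; case ha: (h a) => [c|]; last first.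
    rewrite [X in _ - X]big1 => [|b _]; last by rewrite mul0r.
    rewrite subr0; case: asboolP => // /(_ 1%N); by rewrite /= ha.
  rewrite (bigD1 c) //= eqxx mul1r [X in _ - (_ + X)]big1 => [|b]; last first.
    rewrite eq_sym => neq_bc; rewrite (_ : (_ == _) = false) ?mul0r //.
    by apply/eqP => -[/eqP]; apply/negP.
  rewrite addr0; apply/eqP; rewrite subr_eq0; apply/eqP; congr (_%:R).
  congr nat_of_bool; apply: asbool_equiv_eq; split=> bad m.
    by have := bad m.+1; rewrite iterSr /= ha.
  by case: m => // m; rewrite iterSr /= ha.
(* Over a mere commutative ring the adjugate is what turns the kernel vector, with entry 1 at [v0],
   into a vanishing determinant. *)
have := congr1 (fun u => (\adj M *m u) v0 0) Mz.
rewrite mulmxA mul_adj_mx mulmx0 mul_scalar_mx !mxE.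
by case: asboolP => // _; rewrite mulr1.
Qed.

(** A matrix-tree theorem: [v] chooses [y] with weight [w v y] and then points to [pi v y], or stops
    if this is [None]. [det_row_sum] expands over the choices and [det_rooted] keeps the acyclic
    ones. *)
Lemma det_forest (R : comNzRingType) (T Y : finType) (pi : T -> Y -> option T)
    (w : T -> Y -> R) :
  \det (\matrix_(a < #|T|, b < #|T|) \sum_y w (enum_val a) y *
      ((a == b)%:R - (pi (enum_val a) y == Some (enum_val b))%:R)) =
  \sum_(g : {ffun T -> Y} | `[< rooted (fun v => pi v (g v)) >])
    \prod_v w v (g v).
Proof.
rewrite det_row_sum [RHS]big_mkcond /=.
pose e (g : {ffun T -> Y}) : {ffun 'I_#|T| -> Y} := [ffun a => g (enum_val a)].
rewrite (reindex e) /=; last first.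
  by exists (fun f => [ffun v => f (enum_rank v)]) => f _; apply/ffunP => a;
    rewrite !ffunE ?enum_valK ?enum_rankK.
apply: eq_bigr => g _.
pose h (a : 'I_#|T|) : option 'I_#|T| := omap enum_rank (pi (enum_val a) (g (enum_val a))).
rewrite [X in _ * \det X](_ : _ =
    \matrix_(a, b) ((a == b)%:R - (h a == Some b)%:R)); last first.
  apply/matrixP => a b; rewrite !mxE ffunE /h; congr (_ - (nat_of_bool _)%:R).
  case: (pi _ _) => // v /=; rewrite -[in RHS](enum_valK b).
  by rewrite /eq_op /= (inj_eq enum_rank_inj).
rewrite det_rooted.
have -> : `[< rooted h >] = `[< rooted (fun v => pi v (g v)) >].
  have iterE m v : iter m (obind h) (Some (enum_rank v)) =
      omap enum_rank (iter m (obind (fun v => pi v (g v))) (Some v)).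
    by elim: m => //= m ->; case: (iter m _ (Some v)) => //= u; rewrite /h enum_rankK.
  apply: asbool_equiv_eq; split=> root v.
    have [m] := root (enum_rank v); rewrite iterE => Em.
    by exists m; case: (iter _ _ _) Em.
  have [m Em] := root (enum_val v); exists m.
  by rewrite -[v]enum_valK iterE Em.
case: asboolP => _; rewrite ?mulr0 // mulr1.
rewrite [RHS](reindex (@enum_val _ (mem T))); last exact/onW_bij/enum_val_bij.
by apply: eq_bigr => a _; rewrite ffunE.
Qed.

Lemma val_iter_ordS (k : nat) (i : 'I_k) m :
  val (iter m (@ordS k) i) = ((i + m) %% k)%N.
Proof.
elim: m => [|m IHm] /=; first by rewrite addn0 modn_small.
by move: IHm => /= ->; rewrite -addn1 modnDml addn1 addnS.
Qed.

(** Split p_i = (p_i - q_i) + q_i: at [i] one stops with weight p_i - q_i or moves to [ordS i] with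
    weight q_i. Only the choice of always moving is not rooted, and its weight is the product of the
    q_i. *)
Lemma det_cyclic_bidiag (R : comNzRingType) (k : nat) (p q : 'I_k -> R) :
  (0 < k)%N ->
  \det (\matrix_(i, j) (p i *+ (i == j) - q i *+ (ordS i == j))) =
  \prod_i p i - \prod_i q i.
Proof.
move=> k_gt0.
pose w i (y : bool) := if y then q i else p i - q i.
pose h (f : 'I_k -> bool) i := if f i then Some (ordS i) else None.
have wE i : \sum_y w i y = p i by rewrite big_bool /= addrC subrK.
rewrite [X in \det X](_ : _ = \matrix_(i, j) \sum_y w i y *
    ((i == j)%:R - (h (fun=> y) i == Some j)%:R)); last first.
  apply/matrixP => i j; rewrite !mxE big_bool /= subr0 /eq_op /=.
  by rewrite mulrBr addrAC -mulrDl (addrC (q i)) subrK !mulr_natr.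
have rootE (f : {ffun 'I_k -> bool}) : `[< rooted (h f) >] = (f != [ffun=> true]).
  apply/asboolP/idP => [root_h | neq_f v].
    apply/eqP => fT; have [m] := root_h (Ordinal k_gt0).
    suff -> : iter m (obind (h f)) (Some (Ordinal k_gt0)) =
              Some (iter m (@ordS k) (Ordinal k_gt0)) by [].
    by elim: m => //= m ->; rewrite /= /h fT ffunE.
  have [a /negbTE fa] : exists a, ~~ f a.
    apply/existsP; apply: contra_neqT neq_f; rewrite negb_exists => /forallP f_true.
    by apply/ffunP => a; rewrite ffunE; apply/negPn/f_true.
  apply: contrapT => /forallNP never.
  have iterE m : iter m (obind (h f)) (Some v) = Some (iter m (@ordS k) v).
    elim: m => //= m IHm; have := never m.+1; rewrite /= IHm /= /h.
    by case: (f _).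
  (* Going around from [v], this many steps lead to [a], where [f] stops. *)
  have := never (k - v + a).+1; rewrite /= iterE /=.
  suff -> : iter (k - v + a) (@ordS k) v = a by rewrite /h fa.
  apply: val_inj; rewrite val_iter_ordS addnA subnKC ?(ltnW (ltn_ord v)) //.
  by rewrite modnDl modn_small.
rewrite det_row_sum.
transitivity (\sum_(f : {ffun 'I_k -> bool})
    (\prod_i w i (f i)) * (f != [ffun=> true])%:R).
  by apply: eq_bigr => f _; rewrite -rootE -det_rooted.
rewrite (bigD1 [ffun=> true]) //= eqxx mulr0 add0r.
have -> : \prod_i p i = \sum_(f : {ffun 'I_k -> bool}) \prod_i w i (f i).
  by rewrite -bigA_distr_bigA; apply: eq_bigr => i _; rewrite wE.
rewrite [in RHS](bigD1 [ffun=> true]) //= addrAC.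
rewrite [X in X - _](_ : _ = \prod_i q i) ?subrr ?add0r; last first.
  by apply: eq_bigr => i _; rewrite ffunE.
by apply: eq_bigr => f ->; rewrite mulr1.
Qed.

(** A matrix determinant lemma without inverses: the block matrix with blocks [D], [U], [V], 1 is
    made triangular in two ways, and the hypothesis clears the upper right block in the second. *)
Lemma det_sub_mulmx (R : comNzRingType) (m n : nat) (D : 'M[R]_m)
    (U : 'M_(m, n)) (V : 'M_(n, m)) (P : 'M_n) :
  D *m U = U *m P ->
  \det (D - U *m V) * \det P = \det D * \det (P - V *m U).
Proof.
move=> DU.
have detK : \det (block_mx D U V 1%:M) = \det (D - U *m V).
  have := det_mulmx (block_mx D U V 1%:M) (block_mx 1%:M 0 (- V) 1%:M).
  rewrite mulmx_block det_lblock !det1 !mulr1 => <-.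
  rewrite !mulmx1 !mulmx0 !mul1mx !add0r mulmxN addrN det_ublock det1 mulr1.
  by [].
rewrite -detK.
have := det_mulmx (block_mx D U V 1%:M) (block_mx 1%:M (- U) 0 P).
rewrite mulmx_block det_ublock det1 mul1r => <-.
rewrite !mulmx1 !mulmx0 !mul1mx !addr0 !mulmxN DU addNr det_lblock.
by rewrite [- _ + P]addrC.
Qed.

Lemma big_tag_eq (R : Type) (idx : R) (op : Monoid.com_law idx) (I : finType)
    (X : I -> finType) (P : pred {i : I & X i}) (F : {i : I & X i} -> R) (i : I) :
  \big[op/idx]_(u | (tag u == i) && P u) F u =
  \big[op/idx]_(v : X i | P (Tagged X v)) F (Tagged X v).
Proof.
pose Q j (v : X j) := P (Tagged X v); pose G j (v : X j) := F (Tagged X v).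
have := @sig_big_dep _ _ op _ _ (pred1 i) Q G; rewrite big_pred1_eq => ->.
by apply: eq_big => -[j v].
Qed.

Section ForestWeight.
Variables (R : idomainType) (k : nat) (X : 'I_k -> finType).
Notation U := {i : 'I_k & X i}.
Variables (x : U -> R) (A : {set U}) (c : U -> U) (N : nat).
Hypothesis k_gt0 : (0 < k)%N.
Hypothesis cA : forall v, v \in A -> c v \in A.
Hypothesis cardA : forall i, #|[set v : X i | Tagged X v \in A]| = N.

Let p i := \sum_(v : X i) x (Tagged X v).
Let q i := \sum_(v : X i | Tagged X v \notin A) x (Tagged X v).

Hypothesis p_neq0 : forall i, p i != 0.

Let e i := (#|X (ord_pred i)| - N)%N.

Lemma card_notinA i : #|[set v : X i | Tagged X v \notin A]| = (#|X i| - N)%N.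
Proof.
rewrite -(cardA i) [LHS]cardsCs; congr (_ - #|pred_of_set _|)%N.
by apply/setP => v; rewrite !inE negbK.
Qed.

(** The exponent [e i] counts the points off [A] in the class before [i], whose images range over
    [X i]. *)
Lemma prod_notinA : \prod_(v | v \notin A) p (ordS (tag v)) = \prod_i p i ^+ e i.
Proof.
rewrite [RHS](reindex_inj (can_inj (@ordSK k))) /=.
rewrite (partition_big (@tag _ _) xpredT) //=; apply: eq_bigr => i _.
under eq_bigl do rewrite andbC; rewrite big_tag_eq /e ordSK -card_notinA.
by rewrite -prodr_const; apply: eq_bigl => v; rewrite !inE.
Qed.

(** The weights out of a point off [A] depend only on its class, so the matrix of [det_forest] is
    diagonal minus a product through dimension [k]. [det_sub_mulmx] reduces it to a cyclic
    bidiagonal determinant, up to the factor prod_i p_i, which is then cancelled. *)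
Lemma forest_weight :
  \sum_(g : {ffun U -> U} |
      `[< rooted (fun v => if g v \in A then None else Some (g v)) >])
    \prod_v (x (g v) *+ (if v \in A then g v == c v
                         else tag (g v) == ordS (tag v))) =
  \prod_(v in A) x (c v) *
    (\prod_i p i ^+ e i - \prod_i (p i ^+ (#|X (ord_pred i)| - N.+1) * q i)).
Proof.
pose pi (v u : U) := if u \in A then None else Some u.
pose w v u := x u *+ (if v \in A then u == c v else tag u == ordS (tag v)).
rewrite -(det_forest pi w).
pose d v := if v \in A then x (c v) else p (ordS (tag v)).
pose D : 'M[R]_#|{: U}| := diag_mx (\row_a d (enum_val a)).
pose P : 'M[R]_k := diag_mx (\row_i p i).
(* [Um] records the class into which a point off [A] is sent, [V] the weights of the points off [A]
   in each class. *)
pose Um : 'M[R]_(#|{: U}|, k) := \matrix_(a, i)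
  ((enum_val a \notin A) && (ordS (tag (enum_val a)) == i))%:R.
pose V : 'M[R]_(k, #|{: U}|) := \matrix_(i, b)
  (x (enum_val b) *+ ((tag (enum_val b) == i) && (enum_val b \notin A))).
have -> : \matrix_(a < #|{: U}|, b < #|{: U}|) (\sum_y w (enum_val a) y *
      ((a == b)%:R - (pi (enum_val a) y == Some (enum_val b))%:R)) = D - Um *m V.
  apply/matrixP => a b; rewrite !mxE; under eq_bigr do rewrite mulrBr.
  rewrite sumrB -mulr_suml; congr (_ - _).
    rewrite mulr_natr; congr (_ *+ _); rewrite /w /d.
    case: ifP => _.
      by rewrite (bigD1 (c (enum_val a))) //= eqxx big1 ?addr0 // => u /negbTE->.
    rewrite -[p _](big_tag_eq _ xpredT x) [RHS]big_mkcond.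
    by apply: eq_bigr => u _; rewrite andbT mulrb.
  rewrite (bigD1 (ordS (tag (enum_val a)))) //= [X in _ + X]big1 ?addr0; last first.
    by move=> i neq_i; rewrite !mxE [_ == i]eq_sym (negbTE neq_i) andbF mul0r.
  rewrite !mxE eqxx andbT (bigD1 (enum_val b)) //= [X in _ + X]big1 ?addr0; last first.
    move=> u neq_u; rewrite /pi; case: ifP => _; first by rewrite mulr0.
    by rewrite /eq_op /= (negbTE neq_u) mulr0.
  rewrite /w /pi; case: ifP => aA; last first.
    by rewrite mul1r; case: ifP => _; rewrite ?andbF ?mulr0 // andbT eqxx mulr1.
  rewrite mul0r; case: ifP => [_ | bA]; first by rewrite mulr0.
  by rewrite (_ : _ == c _ = false) ?mul0r //; apply: contraFF bA => /eqP->; exact: cA.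
have DU : D *m Um = Um *m P.
  apply/matrixP => a i; rewrite mul_diag_mx mul_mx_diag !mxE /d.
  by case: ifP => _ /=; rewrite ?mulr0 ?mul0r // mulrC; case: eqP => [->|]; rewrite ?mul0r.
have detD : \det D = \prod_u d u.
  rewrite det_diag (reindex (@enum_rank U)) /=; last exact/onW_bij/enum_rank_bij.
  by apply: eq_bigr => u _; rewrite mxE enum_rankK.
have detP : \det P = \prod_i p i.
  by rewrite det_diag; apply: eq_bigr => i _; rewrite mxE.
have := det_sub_mulmx V DU; rewrite detD detP.
have -> : P - V *m Um = \matrix_(i, j) (p i *+ (i == j) - q i *+ (ordS i == j)).
  apply/matrixP => i j; rewrite !mxE; congr (_ - _).
  rewrite (reindex (@enum_rank U)) /=; last exact/onW_bij/enum_rank_bij.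
  rewrite -[q i](big_tag_eq _ (fun u => u \notin A) x) -sumrMnl [RHS]big_mkcond /=.
  apply: eq_bigr => u _; rewrite !mxE enum_rankK.
  case: eqP => [<- | _]; rewrite ?mul0r //=.
  by case: (u \in A); rewrite /= ?mul0r // mulr_natr.
rewrite det_cyclic_bidiag // => detE.
have p_prod_neq0 : \prod_i p i != 0 by apply/prodf_neq0.
apply: (mulIf p_prod_neq0); rewrite detE.
rewrite (bigID (mem A)) /=.
rewrite (eq_bigr (x \o c)) => [|v vA]; last by rewrite /d vA.
rewrite [X in _ * X * _ = _](eq_bigr (fun v => p (ordS (tag v)))) => [|v /negbTE vA];
  last by rewrite /d vA.
rewrite prod_notinA -!mulrA; congr (_ * _).
rewrite mulrBr mulrBl; congr (_ - _).
rewrite -!big_split /=.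
(* Removing a factor p_i from [p i ^+ e i] requires [e i > 0]. If [A] fills the class before [i],
   this fails, but then the [q] of that class is an empty sum and both sides vanish. *)
have [/existsP[j /eqP qj0] | ] := boolP [exists j, q j == 0].
  by rewrite (bigD1 j) //= [RHS](bigD1 j) //= qj0 !(mulr0, mul0r).
rewrite negb_exists => /forallP q_neq0; apply: eq_bigr => i _.
rewrite mulrAC -exprSr; congr (_ ^+ _ * _); rewrite /e subnS prednK //.
rewrite -card_notinA card_gt0; apply: contraNneq (q_neq0 (ord_pred i)) => A0.
rewrite /q big1 // => v vA.
by have /setP/(_ v) := A0; rewrite !inE vA.
Qed.

End ForestWeight.

(** * Cycles of tuples *)

Lemma Tagged_inj (I : eqType) (T : I -> eqType) (i : I) :
  injective (@Tagged I i (fun j => T j)).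
Proof. by move=> v w /eqP; rewrite -tag_eqE /tag_eq eqxx tagged_asE => /eqP. Qed.

Section EventuallyCyclicOrbit.
Variables (k N : nat) (X : 'I_k -> finType) (f : cyctuple X).
Hypotheses (hk : (0 < k)%N) (hN : (0 < N)%N).
Let i0 := Ordinal hk.
Let c := @cycreturn k X f i0.

Lemma tag_iter_cycstep m u :
  tag (iter m (cycstep f) u) = iter m (@ordS k) (tag u).
Proof. by elim: m => //= m <-. Qed.

Lemma iter_cycreturn m v : Tagged X (iter m c v) = iter (m * k) (cycstep f) (Tagged X v).
Proof. by elim: m => //= m IHm; rewrite cycreturnP IHm -iterD mulSn. Qed.

Lemma iter_ordS_eq m (i : 'I_k) : (iter m (@ordS k) i == i) = (k %| m)%N.
Proof.
rewrite -val_eqE /= val_iter_ordS -[X in _ == X](modn_small (ltn_ord i)).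
by rewrite -[X in _ == X %[mod _]]addn0 eqn_modDl mod0n.
Qed.

(** Describes the points of the eventual cycle in X_1 without reference to the stable image. *)
Definition cycle_start (x : X i0) : Prop :=
  [/\ iter N c x = x,
      forall a b, (a < N)%N -> (b < N)%N -> iter a c x = iter b c x -> a = b
    & forall u, exists m, iter m (cycstep f) u = Tagged X x].

Lemma eventually_cyclic_start :
  eventually_cyclic i0 N f ->
  exists2 A : {set X i0}, #|A| = N & forall x, cycle_start x <-> x \in A.
Proof.
case=> A [[m0 Am0] cardA [s [s_uniq sA s_cyc]]]; exists A => // x.
have size_s : size s = N by rewrite -cardA -(eq_card sA); apply/esym/card_uniqP.
split=> [[cN _ _] | xA].
  (* [x] is its own image after [N * m0] returns, when the images have stabilised. *)
  rewrite -(Am0 (N * m0)%N) ?leq_pmull //; apply/imsetP; exists x => //.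
  by rewrite mulnC; elim: (m0) => //= m IHm; rewrite mulSn iterD -IHm cN.
have xs : x \in s by rewrite sA.
have ord_x : fingraph.order c x = N by rewrite (order_cycle s_cyc).
split=> [|a b ltaN ltbN|u].
- by rewrite -ord_x (iter_order_cycle s_cyc).
- by rewrite -ord_x in ltaN ltbN; move/(congr1 (findex c x)); rewrite !findex_iter.
(* Three stages lead from [u] to [x]: on to X_1, then [m0] returns to land in [A], then along the
   cycle. *)
have [n tag_n] : exists n, tag (iter n (cycstep f) u) = i0.
  exists (k - tag u)%N; rewrite tag_iter_cycstep; apply: val_inj.
  by rewrite val_iter_ordS subnKC ?modnn // ltnW.
case Du: (iter n (cycstep f) u) tag_n => [j v] /= ej; subst j.
have vA : iter m0 c v \in A by rewrite -(Am0 m0) // imset_f.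
have /iter_findex E : fconnect c (iter m0 c v) x.
  by rewrite (fconnect_cycle s_cyc) ?sA.
exists ((findex c (iter m0 c v) x + m0) * k + n)%N.
by rewrite iterD Du -iter_cycreturn iterD E.
Qed.

Lemma start_eventually_cyclic x : cycle_start x -> eventually_cyclic i0 N f.
Proof.
case=> cN c_inj reach.
have cNm m : iter (N * m) c x = x.
  by rewrite mulnC; elim: m => // m IHm; rewrite mulSn iterD IHm.
(* A path from X_1 to X_1 has length divisible by [k], so it consists of whole returns. *)
have reach_c v : {m | iter m c v = x}.
  apply: cid; have [m Em] := reach (Tagged X v).
  have /dvdnP[q Dm] : (k %| m)%N.
    by rewrite -(iter_ordS_eq m i0) -[X in iter m _ X]/(tag (Tagged X v))
      -tag_iter_cycstep Em.
  by exists q; move: Em; rewrite Dm -iter_cycreturn => /Tagged_inj.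
exists [set iter j c x | j : 'I_N]; split.
- exists (\max_v sval (reach_c v)) => m le_m; apply/setP => y.
  apply/imsetP/imsetP => [[v _ ->] | [j _ ->]].
    have le_vm : (sval (reach_c v) <= m)%N by apply: leq_trans le_m; apply: leq_bigmax.
    exists (Ordinal (ltn_pmod (m - sval (reach_c v)) hN)) => //=.
    rewrite -{1}(subnK le_vm) iterD (svalP (reach_c v)).
    rewrite {1}(divn_eq (m - _) N) addnC iterD [(_ %/ _ * _)%N]mulnC.
    by rewrite cNm.
  (* After [m] further returns the total is [j + N * m], which is [j] modulo the period. *)
  exists (iter (j + (N * m - m)) c x) => //.
  by rewrite -iterD addnCA subnKC ?leq_pmull // iterD cNm.
- rewrite card_imset ?card_ord // => a b /c_inj eq_ab.
  exact/val_inj/eq_ab.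
exists (traject c x N); split.
- apply/(uniqP x) => a b; rewrite !inE size_traject => ltaN ltbN.
  by rewrite !nth_traject // => /c_inj; apply.
- move=> y; apply/trajectP/imsetP => [[j ltjN ->] | [j _ ->]]; last by exists j.
  by exists (Ordinal ltjN).
case: N hN cN => // n _ cn; rewrite /= rcons_path fpath_traject last_traject.
by apply/eqP.
Qed.

End EventuallyCyclicOrbit.

Definition rooted_in (T : finType) (A : {set T}) (g : T -> T) : Prop :=
  rooted (fun v => if g v \in A then None else Some (g v)).

(** The exponent is [m.+1] because only images of [v], not [v] itself, are tested for membership in
    [A]. *)
Lemma rooted_inP (T : finType) (A : {set T}) (g : T -> T) :
  rooted_in A g <-> forall v, exists m, iter m.+1 g v \in A.
Proof.
split=> [root_g v | reach v].
  apply: contrapT => /forallNP never; have [m] := root_g v.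
  suff -> : iter m (obind (fun v => if g v \in A then None else Some (g v)))
      (Some v) = Some (iter m g v) by [].
  by elim: m => //= m ->; have /negP/negbTE := never m; rewrite /= => ->.
have [m] := reach v; elim: m v => [|m IHm] v; first by move=> gA; exists 1%N; rewrite /= gA.
rewrite iterSr => /IHm[p Ep]; have [gA | gA] := boolP (g v \in A).
  by exists 1%N; rewrite /= gA.
by exists p.+1; rewrite iterSr /= (negbTE gA).
Qed.

Section MarkedCycles.
Variables (k N : nat) (X : 'I_k -> finType).
Hypotheses (hk : (0 < k)%N) (hN : (0 < N)%N).
Notation U := {i : 'I_k & X i}.
Let i0 := Ordinal hk.
Let j0 := Ordinal hN.

Definition cycfam := {dffun forall i : 'I_k, {ffun 'I_N -> X i}}.

(* A family of injections phi i : 'I_N -> X i marks the cycle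
   phi_0(0), phi_1(0), ..., phi_(k-1)(0), phi_0(1), ... of length k * N. *)
Definition famval (phi : cycfam) (e : 'I_k * 'I_N) : U := Tagged X (phi e.1 e.2).

Definition succ_idx (e : 'I_k * 'I_N) : 'I_k * 'I_N :=
  (ordS e.1, if e.1.+1 == k then ordS e.2 else e.2).

Definition fam_inj (phi : cycfam) := [forall i, injectiveb (phi i)].

Definition fam_support (phi : cycfam) : {set U} := [set famval phi e | e in setT].

Definition fam_next (phi : cycfam) (u : U) : U :=
  if [pick e | famval phi e == u] is Some e then famval phi (succ_idx e) else u.

Definition marked (phi : cycfam) (g : U -> U) : bool :=
  [&& fam_inj phi, [forall u in fam_support phi, g u == fam_next phi u]
    & `[< rooted_in (fam_support phi) g >]].

Lemma famval_inj phi : fam_inj phi -> injective (famval phi).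
Proof.
move=> /forallP inj_phi [i j] [i' j'] /= /eqP; rewrite -tag_eqE /tag_eq /=.
case/andP=> /eqP ei; subst i'; rewrite tagged_asE => /eqP ej.
by congr (_, _); exact: (injectiveP _ (inj_phi i)).
Qed.

Lemma fam_nextE phi e : fam_inj phi ->
  fam_next phi (famval phi e) = famval phi (succ_idx e).
Proof.
move=> inj_phi; rewrite /fam_next.
by case: pickP => [e' /eqP/(famval_inj inj_phi)-> // | /(_ e)]; rewrite eqxx.
Qed.

Lemma fam_next_support phi u : fam_inj phi -> u \in fam_support phi ->
  fam_next phi u \in fam_support phi.
Proof. by move=> inj_phi /imsetP[e _ ->]; rewrite fam_nextE // imset_f. Qed.

Lemma tag_fam_next phi u : fam_inj phi -> u \in fam_support phi ->
  tag (fam_next phi u) = ordS (tag u).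
Proof. by move=> inj_phi /imsetP[e _ ->]; rewrite fam_nextE. Qed.

Lemma iter_succ_idx_lt (i : 'I_k) j : iter i succ_idx (i0, j) = (i, j).
Proof.
case: i => i ltik /=.
elim: i ltik => [|i IHi] ltik /=; first by congr (_, _); apply: val_inj.
rewrite (IHi (ltnW ltik)) /succ_idx /= ltn_eqF //; congr (_, _).
by apply: val_inj; rewrite /= modn_small.
Qed.

Lemma iter_succ_idx_k j : iter k succ_idx (i0, j) = (i0, ordS j).
Proof.
have ltk : (k.-1 < k)%N by rewrite prednK.
rewrite -[X in iter X](prednK hk) /= (iter_succ_idx_lt (Ordinal ltk)).
rewrite /succ_idx /= prednK // eqxx; congr (_, _).
by apply: val_inj; rewrite /= prednK // modnn.
Qed.

Lemma iter_succ_idx_mul m j : iter (m * k) succ_idx (i0, j) = (i0, iter m (@ordS N) j).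
Proof. by elim: m => //= m IHm; rewrite mulSn iterD IHm iter_succ_idx_k. Qed.

Lemma iter_ordS0 m : (m < N)%N -> iter m (@ordS N) j0 = m :> nat.
Proof. by move=> ltmN; rewrite val_iter_ordS add0n modn_small. Qed.

Lemma iter_succ_idxE (e : 'I_k * 'I_N) : iter (e.2 * k + e.1) succ_idx (i0, j0) = e.
Proof.
rewrite addnC iterD iter_succ_idx_mul.
have -> : iter e.2 (@ordS N) j0 = e.2 by apply: val_inj; rewrite /= iter_ordS0.
by rewrite iter_succ_idx_lt; case: e.
Qed.

Variable f : cyctuple X.
Let g := cycstep f.

Lemma marked_iter phi m : marked phi g ->
  iter m g (famval phi (i0, j0)) = famval phi (iter m succ_idx (i0, j0)).
Proof.
case/and3P=> inj_phi /'forall_implyP gE _.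
by elim: m => //= m ->; rewrite -fam_nextE //; apply/eqP/gE; rewrite imset_f.
Qed.

Lemma marked_start phi : marked phi g -> cycle_start N f (hk := hk) (phi i0 j0).
Proof.
move=> mark; have iterE := marked_iter _ mark.
have inj_phi : fam_inj phi by case/and3P: mark.
have cE m : iter m (@cycreturn k X f i0) (phi i0 j0) = phi i0 (iter m (@ordS N) j0).
  by have := iterE (m * k)%N; rewrite -iter_cycreturn iter_succ_idx_mul => /Tagged_inj.
split.
- rewrite cE; congr (phi _ _); apply: val_inj.
  by rewrite val_iter_ordS add0n modnn.
- move=> a b ltaN ltbN; rewrite !cE.
  have /forallP/(_ i0)/injectiveP inj0 := inj_phi.
  by move/inj0/(congr1 val); rewrite /= !iter_ordS0.
- move=> u; have /and3P[_ _ /asboolP/rooted_inP/(_ u)[m]] := mark.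
  case/imsetP=> e _ Em.
  have le_e : (e.2 * k + e.1 <= N * k)%N.
    by rewrite (leq_trans _ (leq_mul (ltn_ord e.2) (leqnn k))) // mulSn addnC leq_add2r ltnW.
  (* The index [e] sits at position [e.2 * k + e.1] on the cycle of length [N * k]; the remaining
     steps close the cycle. *)
  exists ((N * k - (e.2 * k + e.1)) + m.+1)%N.
  have Ee := iterE (e.2 * k + e.1)%N; rewrite iter_succ_idxE in Ee.
  rewrite iterD -/g Em -Ee -iterD subnK //.
  rewrite iterE iter_succ_idx_mul; congr (famval phi (_, _)); apply: val_inj.
  by rewrite val_iter_ordS add0n modnn.
Qed.

Lemma marked_uniq phi phi' : marked phi g -> marked phi' g ->
  phi i0 j0 = phi' i0 j0 -> phi = phi'.
Proof.
move=> mark mark' eq0; apply/ffunP => i; apply/ffunP => j.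
have := marked_iter (j * k + i) mark; have := marked_iter (j * k + i) mark'.
by rewrite (iter_succ_idxE (i, j)) /famval /= eq0 => -> /Tagged_inj.
Qed.

(** Let [phi i j] be the point reached from [x] after [j * k + i] steps. *)
Lemma start_marked x : cycle_start N f (hk := hk) x ->
  exists2 phi, marked phi g & phi i0 j0 = x.
Proof.
case=> cN c_inj reach; set u0 := Tagged X x in reach.
have iterN m : iter (m + N * k) g u0 = iter m g u0.
  by rewrite iterD -[iter (N * k) g u0]iter_cycreturn cN.
have ex_val (e : 'I_k * 'I_N) : {y : X e.1 | iter (e.2 * k + e.1) g u0 = Tagged X y}.
  have : tag (iter (e.2 * k + e.1) g u0) = e.1.
    rewrite tag_iter_cycstep; apply: val_inj.
    by rewrite val_iter_ordS add0n modnMDl modn_small.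
  by case: (iter _ g u0) => i y /= ei; subst i; exists y.
pose phi : cycfam := [ffun i => [ffun j => sval (ex_val (i, j))]].
have phiE e : famval phi e = iter (e.2 * k + e.1) g u0.
  by case: e => i j; rewrite /famval !ffunE; apply/esym/(svalP (ex_val (i, j))).
have phi_next e : famval phi (succ_idx e) = g (famval phi e).
  rewrite !phiE -iterS -addnS /succ_idx; case: e => i j /=.
  case: eqP => [ei | /eqP ni]; last first.
    by rewrite modn_small // ltn_neqAle ni /=.
  rewrite ei modnn addn0 -mulSnr /=; have [->|nj] := eqVneq j.+1 N.
    by rewrite modnn -[in RHS](add0n (N * k)%N) iterN.
  by rewrite modn_small // ltn_neqAle nj /=.
have inj_phi : fam_inj phi.
  apply/forallP => i; apply/injectiveP => j j' eq_j.
  have : famval phi (i, j) = famval phi (i, j') by rewrite /famval /= eq_j.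
  (* Pushing both points on to X_1 turns them into the [j]-th and [j']-th returns of [x], which
     differ unless [j = j']. *)
  rewrite !phiE /= => /(congr1 (iter (N * k - i) g)).
  have le_i : (i <= N * k)%N by rewrite (leq_trans (ltnW (ltn_ord i))) // leq_pmull.
  rewrite -!iterD ![(_ - _ + _)%N]addnC -!addnA !subnKC // !iterN.
  by rewrite -!iter_cycreturn => /Tagged_inj/c_inj eq_jj; apply/val_inj/eq_jj.
exists phi; last first.
  exact: (@Tagged_inj _ X _ _ _ (phiE (i0, j0))).
apply/and3P; split=> //.
  apply/'forall_implyP => u /imsetP[e _ ->].
  by rewrite fam_nextE // phi_next.
apply/asboolP/rooted_inP => v; have [m Em] := reach (g v).
by exists m; rewrite iterSr Em; apply/imsetP; exists (i0, j0); rewrite ?phiE.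
Qed.

(** A marking amounts to its starting point [phi i0 j0], any of the [N] cycle points in X_1. *)
Lemma count_marked :
  (\sum_(phi | marked phi g) 1 = N * `[< eventually_cyclic i0 N f >])%N.
Proof.
rewrite (partition_big (fun phi : cycfam => phi i0 j0)
  (fun x => `[< cycle_start N f (hk := hk) x >])) /=; last first.
  by move=> phi mark; apply/asboolP/marked_start.
transitivity (\sum_(x | `[< cycle_start N f (hk := hk) x >]) 1)%N.
  apply: eq_bigr => x /asboolP/start_marked[phi mark phi0].
  rewrite (bigD1 phi) /=; last by rewrite mark phi0 eqxx.
  rewrite big1 // => phi' /andP[/andP[mark' /eqP phi0']] /eqP[].
  by apply: marked_uniq; rewrite // phi0 phi0'.
have [/eventually_cyclic_start[] // A cardA startA | notEC] := asboolP.
  rewrite muln1 -[RHS]cardA -sum1_card; apply: eq_bigl => x.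
  by apply/asboolP/idP => /startA.
rewrite muln0 big1 // => x /asboolP/(start_eventually_cyclic hN).
by move=> EC; case: notEC.
Qed.

End MarkedCycles.

(** * Generating polynomial *)

(** An injection of r + 1 points is one of r points plus a value off its image, placed here at
    [ord0]. *)
Lemma sum_injective_extend (R : comPzSemiRingType) (T : finType) (y : T -> R) (r : nat) :
  \sum_(t : {ffun 'I_r -> T} | injectiveb t)
    (\prod_a y (t a)) * (\sum_(v | v \notin codom t) y v) = injsum y r.+1.
Proof.
under eq_bigr do rewrite mulr_sumr.
rewrite pair_big_dep /= /injsum.
pose ext (tv : {ffun 'I_r -> T} * T) : {ffun 'I_r.+1 -> T} :=
  [ffun a => if unlift ord0 a is Some b then tv.1 b else tv.2].
have extS tv b : ext tv (lift ord0 b) = tv.1 b by rewrite ffunE liftK.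
have ext0 tv : ext tv ord0 = tv.2 by rewrite ffunE unlift_none.
rewrite [RHS](reindex ext) /=; last first.
  exists (fun t => ([ffun b => t (lift ord0 b)], t ord0)) => [[t v] _ | t _].
    by rewrite ext0; congr (_, _); apply/ffunP => b; rewrite ffunE extS.
  by apply/ffunP => a; rewrite ffunE; case: unliftP => [b ->|->] /=; rewrite ?ffunE.
apply: eq_big => [[t v] /= | [t v] _]; last first.
  by rewrite big_ord_recl ext0 mulrC /=; congr (_ * _); apply: eq_bigr => b _; rewrite extS.
apply/andP/injectiveP => [[/injectiveP inj_t v_notin] a b | inj_e].
  case: (unliftP ord0 a) => [a' ->|->]; case: (unliftP ord0 b) => [b' ->|->];
    rewrite ?extS ?ext0 //= => E.
  - by rewrite (inj_t _ _ E).
  - by rewrite -E codom_f in v_notin.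
  - by rewrite E codom_f in v_notin.
split.
  apply/injectiveP => a b E; apply: (@lift_inj _ ord0); apply: inj_e.
  by rewrite !extS.
apply/negP => /codomP[b E]; have := neq_lift ord0 b; case/eqP; apply: inj_e.
by rewrite extS ext0.
Qed.

Section CycleCount.
Variables (R : idomainType) (k N : nat) (X : 'I_k -> finType).
Notation U := {i : 'I_k & X i}.
Variable x : U -> R.
Hypotheses (hk : (0 < k)%N) (hN : (0 < N)%N).

(** Brings the sum into the form of [forest_weight]: tuples embed by [cycstep] into the self-maps of
    the disjoint union, and a self-map that breaks the class or cycle condition has weight 0 on the
    right. *)
Lemma sum_marked (phi : cycfam N X) : fam_inj phi ->
  \sum_(f : cyctuple X | marked phi (cycstep f))
     \prod_i \prod_(v : X i) x (Tagged X (f i v)) =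
  \sum_(g : {ffun U -> U} | `[< rooted_in (fam_support phi) g >])
    \prod_v (x (g v) *+ (if v \in fam_support phi then g v == fam_next phi v
                         else tag (g v) == ordS (tag v))).
Proof.
move=> inj_phi.
pose h (f : cyctuple X) : {ffun U -> U} := [ffun u => cycstep f u].
pose ok (g : {ffun U -> U}) := [forall v, if v \in fam_support phi
  then g v == fam_next phi v else tag (g v) == ordS (tag v)].
have h_inj : injective h.
  move=> f f' /ffunP eq_h; apply/ffunP => i; apply/ffunP => v.
  by have := eq_h (Tagged X v); rewrite !ffunE => /Tagged_inj.
have rootedE f : rooted_in (fam_support phi) (h f) <->
                 rooted_in (fam_support phi) (cycstep f).
  have -> // : (h f : U -> U) = cycstep f by apply/funext => u; rewrite ffunE.
transitivity (\sum_(g in [set h f | f : cyctuple X & marked phi (cycstep f)])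
    \prod_v x (g v)).
  rewrite big_imset /=; last by move=> f f' _ _; apply: h_inj.
  apply: eq_big => [f | f _]; first by rewrite inE.
  rewrite sig_big_dep /=; apply: eq_bigr => u _; rewrite ffunE //.
rewrite big_mkcond [RHS]big_mkcond; apply: eq_bigr => g _.
have [ok_g | not_ok] := boolP (ok g); last first.
  rewrite [X in _ = (if _ then X else _)](_ : _ = 0).
    rewrite if_same; case: imsetP => // -[f]; rewrite inE => /and3P[_ /'forall_implyP nextf _] Dg.
    case/negP: not_ok; apply/forallP => u; rewrite Dg ffunE.
    by case: ifP => // /nextf.
  move: not_ok; rewrite negb_forall => /existsP[v /negbTE v_bad].
  by rewrite (bigD1 v) //= v_bad mulr0n mul0r.
have -> : \prod_v (x (g v) *+ (if v \in fam_support phi then g v == fam_next phi v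
    else tag (g v) == ordS (tag v))) = \prod_v x (g v).
  by apply: eq_bigr => v _; rewrite (forallP ok_g v).
suff -> : (g \in [set h f | f : cyctuple X & marked phi (cycstep f)]) =
  `[< rooted_in (fam_support phi) g >] by [].
have tag_g u : tag (g u) = ordS (tag u).
  by have := forallP ok_g u; case: ifP => [uA /eqP-> | _ /eqP//]; apply: tag_fam_next.
have ex_val i (v : X i) : {y : X (ordS i) | g (Tagged X v) = Tagged X y}.
  by have := tag_g (Tagged X v); case: (g _) => j y /= ej; subst j; exists y.
pose f : cyctuple X := [ffun i => [ffun v => sval (ex_val i v)]].
have hf : h f = g.
  apply/ffunP => -[i v]; rewrite ffunE /cycstep !ffunE /=.
  exact/esym/(svalP (ex_val i v)).
apply/imsetP/asboolP => [[f']|].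
  by rewrite inE => /and3P[_ _ /asboolP] + -> => /rootedE.
rewrite -hf => /rootedE root_f; exists f => //; rewrite inE.
apply/and3P; split=> //; last exact/asboolP.
apply/'forall_implyP => u uA.
by have := forallP ok_g u; rewrite uA -{1}hf ffunE.
Qed.

Lemma succ_idx_inj : injective (@succ_idx k N).
Proof.
move=> [i j] [i' j'] /eqP; rewrite xpair_eqE /= (can_eq (@ordSK k)).
case/andP=> /eqP ei /eqP; subst i'.
by case: ifP => _ ej; rewrite ?ej // (can_inj (@ordSK N) ej).
Qed.

Let p i := \sum_(v : X i) x (Tagged X v).
Let y i (v : X i) := x (Tagged X v).

Hypothesis p_neq0 : forall i, p i != 0.

Lemma mem_fam_support (phi : cycfam N X) i (v : X i) :
  (Tagged X v \in fam_support phi) = (v \in codom (phi i)).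
Proof.
apply/imsetP/codomP => [[[i' j] _ E] | [j ->]]; last by exists (i, j).
have ei : i = i' by have := congr1 tag E.
by subst i'; exists j; have := Tagged_inj E.
Qed.

(** Double counting of pairs of a tuple and a marking. For a fixed marking the weight is a
    difference of two products over [i] of terms in [phi i], so the sum over markings factors. *)
Lemma EC_weight_sum :
  N%:R * (\sum_(f : cyctuple X | `[< eventually_cyclic (Ordinal hk) N f >])
    \prod_i \prod_(v : X i) x (Tagged X (f i v))) =
  \prod_i (p i ^+ (#|X (ord_pred i)| - N) * injsum (@y i) N) -
  \prod_i (p i ^+ (#|X (ord_pred i)| - N.+1) * injsum (@y i) N.+1).
Proof.
pose W (f : cyctuple X) := \prod_i \prod_(v : X i) x (Tagged X (f i v)).
(* Extension by 0 to non-injective [t] lets the sum range over all families. *)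
pose F i (t : {ffun 'I_N -> X i}) := if injectiveb t then \prod_a y (t a) else 0.
pose q i (t : {ffun 'I_N -> X i}) := \sum_(v | v \notin codom t) y v.
pose e i := (#|X (ord_pred i)| - N)%N.
pose e' i := (#|X (ord_pred i)| - N.+1)%N.
transitivity (\sum_(phi : cycfam N X)
    \sum_(f : cyctuple X | marked phi (cycstep f)) W f).
  rewrite (exchange_big_dep xpredT) //= mulr_sumr big_mkcond /=.
  apply: eq_bigr => f _; rewrite -/(W f) -[RHS]mul1r big_distrr /=.
  have -> : \sum_(phi : cycfam N X | marked phi (cycstep f)) 1 * W f =
      (\sum_(phi : cycfam N X | marked phi (cycstep f)) 1)%N%:R * W f.
    by rewrite natr_sum mulr_suml.
  rewrite (count_marked hk hN f).
  by case: asboolP => _; rewrite ?muln1 // muln0 mul0r.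
transitivity (\sum_(phi : cycfam N X) (\prod_i F i (phi i)) *
    (\prod_i p i ^+ e i - \prod_i (p i ^+ e' i * q i (phi i)))).
  apply: eq_bigr => phi _; have [inj_phi | ninj] := boolP (fam_inj phi); last first.
    rewrite big1 => [|f /and3P[inj_phi _ _]]; last by rewrite inj_phi in ninj.
    move: ninj; rewrite negb_forall => /existsP[i /negbTE ninj].
    by rewrite (bigD1 i) //= /F ninj !mul0r.
  rewrite sum_marked //.
  have inj_i i : injective (phi i) by apply/injectiveP/(forallP inj_phi).
  rewrite (@forest_weight _ _ _ x (fam_support phi) (fam_next phi) N) //.
  - congr (_ * (_ - _)); last first.
      apply: eq_bigr => i _; congr (_ * _).
      by apply: eq_bigl => v; rewrite mem_fam_support.
    rewrite big_imset /=; last by move=> a b _ _; apply: famval_inj.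
    under eq_bigr do rewrite fam_nextE //.
    transitivity (\prod_a x (famval phi (succ_idx a))); first by apply: eq_bigl => a; rewrite inE.
    (* The successor permutes the cycle, so the images of its points are again all its points. *)
    rewrite -(reindex_inj succ_idx_inj (P := xpredT) (F := fun a => x (famval phi a))) /=.
    rewrite -(pair_bigA _ (fun i j => x (famval phi (i, j)))) /=.
    by apply: eq_bigr => i _; rewrite /F (forallP inj_phi).
  - by move=> v; apply: fam_next_support.
  - move=> i; rewrite -[RHS](card_ord N) -(card_codom (inj_i i)).
    by apply: eq_card => v; rewrite inE mem_fam_support.
transitivity (\sum_(phi : cycfam N X) ((\prod_i F i (phi i)) * \prod_i p i ^+ e i)
    - \sum_(phi : cycfam N X) \prod_i (F i (phi i) * (p i ^+ e' i * q i (phi i)))).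
  by rewrite -sumrB; apply: eq_bigr => phi _; rewrite mulrBr -[X in _ - X]big_split.
congr (_ - _).
  rewrite -mulr_suml (bigA_distr_dffun F) mulrC -big_split /=.
  by apply: eq_bigr => i _; rewrite /injsum -big_mkcond.
rewrite (bigA_distr_dffun (fun i t => F i t * (p i ^+ e' i * q i t))).
apply: eq_bigr => i _; rewrite -sum_injective_extend mulr_sumr [RHS]big_mkcond.
by apply: eq_bigr => t _; rewrite /F; case: ifP => _; rewrite ?mul0r // mulrCA.
Qed.

End CycleCount.

(* Perturbing x to x + 'X keeps the sums p_i nonzero, so that the cancellation in
   EC_weight_sum goes through; then set 'X = 0. *)
Lemma EC_weight_sum_numField (C : numFieldType) (k N : nat) (X : 'I_k -> finType)
    (x : {i : 'I_k & X i} -> C) (hk : (0 < k)%N) :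
  (0 < N)%N -> (forall i, 0 < #|X i|)%N ->
  N%:R * (\sum_(f : cyctuple X | `[< eventually_cyclic (Ordinal hk) N f >])
    \prod_i \prod_(v : X i) x (Tagged X (f i v))) =
  \prod_i ((\sum_(v : X i) x (Tagged X v)) ^+ (#|X (ord_pred i)| - N)
             * injsum (fun v : X i => x (Tagged X v)) N) -
  \prod_i ((\sum_(v : X i) x (Tagged X v)) ^+ (#|X (ord_pred i)| - N.+1)
             * injsum (fun v : X i => x (Tagged X v)) N.+1) :> C.
Proof.
move=> hN X_gt0; pose x' u : {poly C} := (x u)%:P + 'X.
pose ev : {rmorphism {poly C} -> C} := horner_eval (0 : C).
have evx u : ev (x' u) = x u by rewrite /ev /= /horner_eval !hornerE.
have x'_sum_neq0 i : \sum_(v : X i) x' (Tagged X v) != 0.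
  (* The coefficient of ['X] in the sum is [#|X i|], non-zero in characteristic 0. *)
  apply/eqP => /(congr1 (fun P : {poly C} => P`_1)); rewrite coef_sum coef0.
  under eq_bigr do rewrite coefD coefC coefX add0r.
  by rewrite sumr_const => /eqP; rewrite pnatr_eq0 -leqn0 leqNgt X_gt0.
have ev_sum i : ev (\sum_(v : X i) x' (Tagged X v)) = \sum_(v : X i) x (Tagged X v).
  by rewrite rmorph_sum; apply: eq_bigr.
have ev_injsum i r : ev (injsum (fun v : X i => x' (Tagged X v)) r) =
    injsum (fun v : X i => x (Tagged X v)) r.
  by rewrite rmorph_sum; apply: eq_bigr => t _; rewrite rmorph_prod; apply: eq_bigr.
have := congr1 ev (EC_weight_sum hk hN x'_sum_neq0).
rewrite rmorphM rmorph_nat rmorphB rmorph_sum !rmorph_prod /= => E.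
transitivity (N%:R * \sum_(f : cyctuple X | `[< eventually_cyclic (Ordinal hk) N f >])
    ev (\prod_i \prod_(v : X i) x' (Tagged X (f i v)))).
  congr (_ * _); apply: eq_bigr => f _; rewrite rmorph_prod; apply: eq_bigr => i _.
  by rewrite rmorph_prod; apply: eq_bigr => v _; rewrite evx.
rewrite E; congr (_ - _); apply: eq_bigr => i _;
  by rewrite rmorphM rmorphXn /= ev_sum ev_injsum.
Qed.

Theorem corollary4p5 (R : realType) (k N : nat) (hk : (1 <= k)%N)
    (hN : (1 <= N)%N) (X : 'I_k -> finType) (hX : forall i, (2 <= #|X i|)%N)
    (x : {i : 'I_k & X i} -> R[i]) (hx : forall v, x v != 0) :
  (EC_poly X R[i] (Ordinal hk) N).@[fun j => x (enum_val j)]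
  = ((N`! ^ k.-1 * N.-1`!)%N)%:R *
    virtual_chi [:: (1, cyc_tensor R[i] X N);
                    (- ((N.+1 ^ k)%N%:Z), cyc_tensor R[i] X N.+1)] x.
Proof.
have -> : (EC_poly X R[i] (Ordinal hk) N).@[fun j => x (enum_val j)] =
    \sum_(f : cyctuple X | `[< eventually_cyclic (Ordinal hk) N f >])
      \prod_i \prod_(v : X i) x (Tagged X (f i v)).
  rewrite rmorph_sum; apply: eq_bigr => f _ /=.
  rewrite rmorph_prod; apply: eq_bigr => i _ /=.
  rewrite rmorph_prod; apply: eq_bigr => v _ /=.
  by rewrite mevalXU enum_rankK.
have N_neq0 : N%:R != 0 :> R[i] by rewrite pnatr_eq0 -lt0n.
apply: (mulfI N_neq0).
rewrite EC_weight_sum_numField // => [|i]; last exact: ltnW.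
rewrite /virtual_chi !big_cons big_nil addr0 /= !chi_cyc_tensor mul1r.
(* The [k] exterior factors each contribute 1/r!, which a factor (r!)^k compensates. *)
have fact_prod r (y z : 'I_k -> R[i]) :
    \prod_i (y i * z i) = (r`! ^ k)%:R * \prod_i (y i * ((r`!)%:R^-1 * z i)).
  have r_neq0 : (r`!)%:R != 0 :> R[i] by rewrite pnatr_eq0 -lt0n fact_gt0.
  rewrite natrX -[X in _ ^+ X]card_ord -prodr_const -big_split /=.
  by apply: eq_bigr => i _; rewrite mulrCA mulVKf.
rewrite mulrA -natrM mulnCA.
have -> : (N * N.-1`!)%N = N`! by case: (N) hN.
rewrite -expnSr prednK // mulrDr; congr (_ + _); first exact: fact_prod.
rewrite mulrA intrN mulrN mulNr; congr (- _).
(* The coefficient (N+1)^k is the quotient of ((N+1)!)^k by (N!)^k. *)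
by rewrite [LHS](fact_prod N.+1) -pmulrn -natrM factS expnMn mulnC.
Qed.
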